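(* Let $\mu$ be a strict partition. Then for every integer $n\ge0$, $$\sum_{|\lambda/\mu|=n}\frac{2^{|\lambda|-\ell(\lambda)-|\mu|+\ell(\mu)}f_{\lambda/\mu}H_\mu}{H_\lambda}\Bigl(\sum_{\square\in\lambda}\binom{c_\square+1}{4}-\sum_{\square\in\mu}\binom{c_\square+1}{4}\Bigr)=\frac23\binom{n}{3}+\frac23|\mu|\binom{n}{2}+\frac1{12}\bigl(q_2(\mu)+|\mu|^2-2|\mu|\bigr)n,$$ where the sum ranges over strict partitions $\lambda\supseteq\mu$ with $|\lambda|-|\mu|=n$.
   Context: A strict partition is a finite strictly decreasing sequence of positive integers $\lambda=(\lambda_1>\cdots>\lambda_\ell)$ (the empty sequence is allowed); $|\lambda|=\sum_i\lambda_i$, $\ell(\lambda)=\ell$, and $\lambda_i=0$ for $i>\ell(\lambda)$. The (shifted Young) diagram of $\lambda$ is the set of boxes $(i,j)$ with $1\le i\le\ell(\lambda)$, $i+1\le j\le i+\lambda_i$ (row $i$, column $j$); $\lambda$ is identified with its diagram. The content of $\square=(i,j)$ is $c_\square=j-i$. The hook length $h_\square$ of $\square=(i,j)\in\lambda$ is the number of boxes of $\lambda$ in row $i$ strictly to the right of $\square$, plus the number of boxes $(i',j)\in\lambda$ with $i'>i$, plus $1$, plus $\lambda_j$; $H_\lambda=\prod_{\square\in\lambda}h_\square$ ($H_\emptyset=1$). Write $\lambda\supseteq\mu$ if $\lambda_i\ge\mu_i$ for all $i$; $\lambda/\mu$ is the set of boxes of $\lambda$ not in $\mu$, $|\lambda/\mu|=|\lambda|-|\mu|$.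 $f_{\lambda/\mu}$ is the number of standard shifted Young tableaux of shape $\lambda/\mu$ (bijective fillings of the boxes of $\lambda/\mu$ with $1,\dots,|\lambda/\mu|$ increasing along rows left to right and columns top to bottom; $f_{\mu/\mu}=1$). For a strict partition $\mu$: an outer corner is a box of $\mu$ whose removal leaves the diagram of a strict partition; let $(\alpha_1,\beta_1),\dots,(\alpha_m,\beta_m)$ be the outer corners with $\alpha_1>\cdots>\alpha_m$, $y_j=\beta_j-\alpha_j$; set $\alpha_{m+1}=0$, $\beta_0=\ell(\mu)+1$, $x_i=\beta_i-\alpha_{i+1}$ ($0\le i\le m$); and $q_2(\mu)=\sum_{i=0}^m\binom{x_i}{2}^2-\sum_{i=1}^m\binom{y_i}{2}^2$. *)

(* Defs.v *)
From HB Require Import structures.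
From mathcomp Require Import all_boot all_order all_algebra.
Set Implicit Arguments. Unset Strict Implicit. Unset Printing Implicit Defensive.
Import Order.TTheory GRing.Theory Num.Theory.

(* A strict partition is represented by the seq nat of its
   parts (lam_1 > ... > lam_l > 0); lam_i = nth 0 lam (i-1) (1-indexed), so
   lam_i = 0 for i > l. Boxes are pairs (row, column), 1-indexed. *)

Definition part (lam : seq nat) (i : nat) : nat := nth 0 lam i.-1.

Definition is_strict (lam : seq nat) : bool :=
  sorted [rel x y | y < x] lam && all (fun x => 0 < x) lam.

Definition diagram (lam : seq nat) : seq (nat * nat) :=
  flatten [seq [seq (i, j) | j <- iota i.+1 (part lam i)] | i <- iota 1 (size lam)].

Definition contains (lam mu : seq nat) : bool :=
  all (fun i => part mu i <= part lam i) (iota 1 (maxn (size lam) (size mu))).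

Definition lam_of (N : nat) (A : {set 'I_N}) : seq nat :=
  sort geq [seq val i | i <- enum A].

(* the (duplicate-free) list of all strict partitions of N; every strict
   partition of N is the decreasing list of its set of parts, a subset of
   {0,..,N} *)
Definition strict_partitions (N : nat) : seq (seq nat) :=
  undup [seq lam_of A | A <- enum [set: {set 'I_N.+1}] &
          is_strict (lam_of A) && (sumn (lam_of A) == N)].

Definition hook (lam : seq nat) (b : nat * nat) : nat :=
  let: (i, j) := b in
  count (fun c => (c.1 == i) && (j < c.2)) (diagram lam)
  + count (fun c => (c.2 == j) && (i < c.1)) (diagram lam)
  + 1 + part lam j.

Definition Hprod (lam : seq nat) : nat := \prod_(b <- diagram lam) hook lam b.

Definition skew (lam mu : seq nat) : seq (nat * nat) :=
  [seq b <- diagram lam | b \notin diagram mu].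

(* A standard filling of the skew shape is encoded by the ordering s of the
   boxes (the box s_k receives label k+1); it is standard iff labels increase
   along rows (left to right) and columns (top to bottom). *)
Definition standard_order (s : seq (nat * nat)) : bool :=
  all (fun b => all (fun c =>
     (((b.1 == c.1) && (b.2 < c.2)) || ((b.2 == c.2) && (b.1 < c.1)))
       ==> (index b s < index c s)) s) s.

Definition nSYT (lam mu : seq nat) : nat :=
  count standard_order (permutations (skew lam mu)).

Definition same_set (D1 D2 : seq (nat * nat)) : bool :=
  all (mem D2) D1 && all (mem D1) D2.

Definition is_outer_corner (mu : seq nat) (b : nat * nat) : bool :=
  (b \in diagram mu) &&
  has (fun nu => same_set (diagram nu) (rem b (diagram mu)))
      (strict_partitions (sumn mu).-1).

Definition corners (mu : seq nat) : seq (nat * nat) :=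
  sort (fun a b => b.1 <= a.1) [seq b <- diagram mu | is_outer_corner mu b].

Definition content_term (lam : seq nat) : nat :=
  \sum_(b <- diagram lam) 'C((b.2 - b.1).+1, 4).

Local Open Scope ring_scope.

Definition alpha (mu : seq nat) (k : nat) : int :=   (* alpha_{m+1} = 0 *)
  (nth (0,0) (corners mu) k.-1).1%:Z.
Definition beta (mu : seq nat) (k : nat) : int :=
  if k == 0 then (size mu).+1%:Z else (nth (0,0) (corners mu) k.-1).2%:Z.

Definition binom2 (z : int) : rat := (z%:~R * (z%:~R - 1)) / 2.

Definition q2 (mu : seq nat) : rat :=
  let m := size (corners mu) in
  \sum_(0 <= i < m.+1) (binom2 (beta mu i - alpha mu i.+1)) ^+ 2
  - \sum_(1 <= j < m.+1) (binom2 (beta mu j - alpha mu j)) ^+ 2.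

(* Main.v *)
Require Import Defs.
From HB Require Import structures.
From mathcomp Require Import all_boot all_order all_algebra.
From mathcomp Require Import zify ring.
Import Order.TTheory GRing.Theory Num.Theory.

(** Let [W lam = 2 ^ (|lam| - l(lam)) / H_lam].  The hook lengths of the first
    row of [a :: t] are [1, ..., a] and the [a + b] for [b] in [t], without the
    [a - b]; hence [H_lam] is the product of the [a!] and of the
    [(a + b) / (a - b)] for [a > b] in [lam].  Put [u x = x (x + 1)] and
    [v x = x (x - 1)].  Enlarging the part [x] of [nu] by one box (where [x = 0]
    creates a new part) multiplies [W] by
      [\prod_(b in nu) (u x - v b) / \prod_(b in nu + {0}, b != x) (u x - u b)],
    which vanishes when the result is not strict.  These are the coefficients of
    a divided difference at the nodes [u x], so the sums over [x] of the weight
    times [1], [u x], [u x ^ 2] are [1], [2 |nu|], [2 |nu|^2 + 2 C], where [C] is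
    the sum of the cubes of the parts of [nu].  As the new box contributes
    [u (u - 2) / 24] to the content sum and [3 u + 1] to [C], and as [q_2 = C],
    induction on [n] along chains of strict partitions gives the formula. *)

(** * Strict partitions and their diagrams *)

Lemma is_strict_cons (a : nat) (t : seq nat) :
  is_strict (a :: t) = [&& 0 < a, all (fun b => b < a) t & is_strict t].
Proof.
rewrite /is_strict /= path_sortedE; last by move=> x y z /=; lia.
by case: (0 < a); rewrite ?andbF //= -!andbA.
Qed.

Lemma strict_gt0 (lam : seq nat) (i : nat) :
  is_strict lam -> (0 < nth 0 lam i) = (i < size lam).
Proof.
move=> /andP[_ /allP h]; case: (ltnP i) => hi; last by rewrite nth_default.
by rewrite h // mem_nth.
Qed.

Lemma strict_nth_lt (lam : seq nat) (i j : nat) :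
  is_strict lam -> i < j -> i < size lam -> nth 0 lam j < nth 0 lam i.
Proof.
elim: lam i j => [|a t IH] i [|j] //=.
rewrite is_strict_cons => /and3P[a0 /allP ha st].
case: i => [|i] /= ij it; last exact: IH.
case: (ltnP j (size t)) => jt; last by rewrite nth_default.
by apply: ha; rewrite mem_nth.
Qed.

Lemma strict_uniq (lam : seq nat) : is_strict lam -> uniq lam.
Proof.
move=> /andP[h _]; apply: sorted_uniq h; first by move=> x y z /=; lia.
by move=> x /=; rewrite ltnn.
Qed.

(** Consecutive parts drop by at least one, so the row ends [i + lam_i] weakly decrease: the columns
    of a shifted diagram have no gaps. *)
Lemma strict_addn (lam : seq nat) (i j : nat) :
  is_strict lam -> i <= j -> j < size lam -> j + nth 0 lam j <= i + nth 0 lam i.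
Proof.
move=> st ij; rewrite -(subnK ij); elim: (j - i) => [|d IH] // h.
have h1 := strict_nth_lt lam (d + i) (d.+1 + i) st.
have := IH; lia.
Qed.

(** Positivity excludes trailing zeros, so the parts read with default 0 fix the length as well. *)
Lemma strict_eq (lam nu : seq nat) : is_strict lam -> is_strict nu ->
  nth 0 lam =1 nth 0 nu -> lam = nu.
Proof.
move=> sl sn e; apply: (@eq_from_nth _ 0) => [|i _]; last exact: e.
apply/eqP; rewrite eqn_leq; apply/andP; split; rewrite leqNgt; apply/negP => h.
  by move: h; rewrite -(strict_gt0 lam) // e strict_gt0 // ltnn.
by move: h; rewrite -(strict_gt0 nu) // -e strict_gt0 // ltnn.
Qed.

Lemma nth_strictP (lam : seq nat) : all (leq 1) lam ->
  (forall i, i.+1 < size lam -> nth 0 lam i.+1 < nth 0 lam i) -> is_strict lam.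
Proof.
move=> h1 h2; rewrite /is_strict; apply/andP; split=> //.
by apply/(sortedP 0).
Qed.

Lemma strict_mem_le (lam : seq nat) (x : nat) : x \in lam -> x <= sumn lam.
Proof. by elim: lam => //= a t IH; rewrite inE => /orP[/eqP->|/IH]; lia. Qed.

Lemma mem_strict_partitions (N : nat) (lam : seq nat) :
  (lam \in strict_partitions N) = is_strict lam && (sumn lam == N).
Proof.
rewrite mem_undup; apply/mapP/andP => [[A]|[st /eqP sN]].
  by rewrite mem_filter => /andP[/andP[h1 h2] _] ->.
(* The parts are at most [sumn lam = N], so their set lives in ['I_N.+1]; they are distinct, so
   sorting it gives back [lam]. *)
pose A := [set i : 'I_N.+1 | val i \in lam].
have e : lam_of A = lam.
  apply: (@sorted_eq _ geq); first by move=> x y z /=; lia.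
  - by move=> x y /=; lia.
  - by apply: sort_sorted => x y /=; lia.
  - by case/andP: st => + _; apply: sub_sorted => x y /=; lia.
  rewrite perm_sort; apply: uniq_perm; last 1 first.
  - move=> x; apply/mapP/idP => [[i]|xl]; first by rewrite mem_enum inE => + ->.
    have xN : x < N.+1 by have := strict_mem_le _ _ xl; lia.
    by exists (Ordinal xN) => //; rewrite mem_enum inE.
  - by rewrite map_inj_uniq ?enum_uniq //; apply: val_inj.
  - exact: strict_uniq.
by exists A; rewrite // mem_filter e st sN eqxx /= mem_enum inE.
Qed.

(** Beyond the last part [nth] returns 0 and the interval of columns is empty, which encodes the
    bound on the row index. *)
Lemma mem_diagram (lam : seq nat) (b : nat * nat) :
  (b \in diagram lam) = [&& 0 < b.1, b.1 < b.2 & b.2 <= b.1 + nth 0 lam b.1.-1].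
Proof.
case: b => r c /=; apply/allpairsPdep/idP => /= [[i [j]]|].
  by rewrite !mem_iota /part => -[hi hj [-> ->]]; lia.
move=> h; exists r, c; split=> //; rewrite mem_iota ?/part; last by lia.
by case: (ltnP r.-1 (size lam)) => hr; [lia|rewrite nth_default in h; lia].
Qed.

Lemma diagram_uniq (lam : seq nat) : uniq (diagram lam).
Proof.
apply: allpairs_uniq_dep => [|i _|[i j] [i' j'] _ _ /= [-> ->] //]; exact: iota_uniq.
Qed.

Lemma contains_nth (lam mu : seq nat) :
  reflect (forall i, nth 0 mu i <= nth 0 lam i) (contains lam mu).
Proof.
apply: (iffP allP) => h i.
  case: (ltnP i (maxn (size lam) (size mu))) => hi.
    by have := h i.+1; rewrite mem_iota /part /=; apply; lia.
  by rewrite nth_default //; lia.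
by move=> _; apply: h.
Qed.

Lemma mem_skew (lam mu : seq nat) (b : nat * nat) :
  (b \in Defs.skew lam mu) = (b \notin diagram mu) && (b \in diagram lam).
Proof. by rewrite mem_filter. Qed.

Lemma sumn_incr_nth (nu : seq nat) (i : nat) : sumn (incr_nth nu i) = (sumn nu).+1.
Proof.
elim: nu i => [|a t IH] [|i] /=; rewrite ?IH ?addnS //.
by elim: i => //= i ->.
Qed.

Lemma diagram_incr_nth (nu : seq nat) (i : nat) :
  perm_eq (diagram (incr_nth nu i))
    ((i.+1, i.+1 + (nth 0 nu i).+1) :: diagram nu).
Proof.
apply: uniq_perm => [||[r c]]; rewrite /= ?diagram_uniq ?andbT //.
  by rewrite mem_diagram /=; lia.
rewrite inE !mem_diagram /= nth_incr_nth xpair_eqE.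
case: (i =P r.-1) => [->|] /=; lia.
Qed.

(** In a strict partition a part 1 is the last one and vanishes with its box; any other part must
    still exceed the next one after losing a box. *)
Definition removable (lam : seq nat) (i : nat) : bool :=
  (i < size lam) && ((nth 0 lam i == 1) || ((nth 0 lam i.+1).+1 < nth 0 lam i)).

Lemma removableP (lam : seq nat) (i : nat) : is_strict lam ->
  reflect (exists nu, [/\ is_strict nu, i <= size nu & incr_nth nu i = lam])
          (removable lam i).
Proof.
move=> sl; apply: (iffP idP); last first.
  move=> [nu [sn hi e]]; apply/andP; split.
    by rewrite -e size_incr_nth; case: ifP; lia.
  rewrite -e !nth_incr_nth eqxx; case: (ltnP i (size nu)) => h.
    have := strict_nth_lt nu i i.+1 sn (ltnSn _) h; lia.
  by rewrite nth_default.
move=> /andP[hi /orP[/eqP h1|h2]].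
  have si : i.+1 = size lam.
    apply/eqP; rewrite eqn_leq hi leqNgt; apply/negP => h.
    have := strict_nth_lt lam i i.+1 sl (ltnSn _) hi.
    by rewrite h1 ltnNge strict_gt0 // h.
  have el : lam = rcons (take i lam) 1.
    by rewrite -h1 -take_nth // si take_size.
  have st : size (take i lam) = i by rewrite size_takel; lia.
  exists (take i lam); rewrite st; split=> //.
    case/andP: sl => s1 s2; apply/andP; split; first exact: take_sorted.
    by apply/allP => x /mem_take; apply: (allP s2).
  rewrite {2}el -{2}st; elim: (take i lam) => //= a t IH.
  by rewrite IH.
set nu := set_nth 0 lam i (nth 0 lam i).-1.
have sz : size nu = size lam by rewrite size_set_nth; apply/maxn_idPr.
have en k : nth 0 nu k = nth 0 lam k - (i == k).
  by rewrite nth_set_nth /= eq_sym; case: (i =P k) => [->|]; lia.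
exists nu; split; last 2 first.
- by rewrite sz ltnW.
- apply: (@eq_from_nth _ 0) => [|k _]; first by rewrite size_incr_nth sz hi.
  by rewrite nth_incr_nth en; case: (i =P k) => [<-|]; lia.
apply: nth_strictP => [|k].
  apply/(all_nthP 0) => k; rewrite sz en => hk.
  by move: (hk); rewrite -strict_gt0 //; case: (i =P k) => [<-|]; lia.
rewrite sz !en => hk; have := strict_nth_lt lam k k.+1 sl (ltnSn _) (ltnW hk).
by case: (i =P k) => [<-|]; lia.
Qed.

Lemma incr_nth_strict_inj (nu nu' : seq nat) (i : nat) : is_strict nu ->
  is_strict nu' -> incr_nth nu i = incr_nth nu' i -> nu = nu'.
Proof.
move=> s s' e; apply: strict_eq => // k.
have : nth 0 (incr_nth nu i) k = nth 0 (incr_nth nu' i) k by rewrite e.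
rewrite !nth_incr_nth; lia.
Qed.

(** * Standard orders and the removal of the last box *)

Definition box_lt (b c : nat * nat) : bool :=
  ((b.1 == c.1) && (b.2 < c.2)) || ((b.2 == c.2) && (b.1 < c.1)).

Definition maximal_in (D : seq (nat * nat)) (b : nat * nat) : bool :=
  all (fun c => ~~ box_lt b c) D.

(** The box placed last carries the largest label, so it only imposes that no box lies after it in
    its row or column. *)
Lemma standard_order_rcons (s : seq (nat * nat)) (b : nat * nat) :
  b \notin s -> standard_order (rcons s b) = standard_order s && maximal_in s b.
Proof.
move=> bs; rewrite /standard_order /maximal_in.
have ib : index b (rcons s b) = size s.
  by rewrite -cats1 index_cat (negbTE bs) /= eqxx addn0.
have is_ c : c \in s -> index c (rcons s b) = index c s.
  by move=> cs; rewrite -cats1 index_cat cs.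
apply/allP/andP => [h|[/allP h1 /allP h2] x].
  split; apply/allP => x xs; have := h x; rewrite mem_rcons inE xs orbT => /(_ isT).
    move/allP => hx; apply/allP => y ys; have := hx y.
    by rewrite mem_rcons inE ys orbT !is_ // => /(_ isT).
  move=> _; have := h b; rewrite mem_rcons mem_head => /(_ isT) /allP /(_ x).
  rewrite mem_rcons inE xs orbT ib is_ // => /(_ isT).
  by rewrite -/(box_lt b x) ltnNge index_size implybF.
rewrite mem_rcons inE => /orP[/eqP ->|xs]; apply/allP => y;
  rewrite mem_rcons inE => /orP[/eqP ->|ys].
- by rewrite !ltnn !andbF.
- by have := h2 y ys; rewrite /box_lt => /negbTE ->.
- by rewrite ib is_ // index_mem xs implybT.
- by rewrite !is_ //; exact: (allP (h1 x xs)).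
Qed.

Definition num_standard (D : seq (nat * nat)) : nat := count standard_order (permutations D).

Lemma num_standard_perm (D D' : seq (nat * nat)) : perm_eq D D' -> num_standard D = num_standard D'.
Proof. by move=> /perm_permutations /permP; apply. Qed.

Lemma permutations_rcons (T : eqType) (D : seq T) : uniq D -> D != [::] ->
  perm_eq (permutations D)
    [seq rcons s b | b <- D, s <- permutations (rem b D)].
Proof.
move=> uD nD; apply: uniq_perm; first exact: permutations_uniq.
  apply: allpairs_uniq_dep => // [b _|[b s] [b' s'] _ _ /= /rcons_inj[-> ->] //].
  exact: permutations_uniq.
move=> s; rewrite mem_permutations; apply/idP/allpairsPdep => [|[b [t]]].
  case/lastP: s => [|s b].
    by rewrite perm_sym => /perm_nilP e; rewrite e in nD.
  move=> h; have bD : b \in D by rewrite -(perm_mem h) mem_rcons mem_head.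
  exists b, s; split=> //; rewrite mem_permutations.
  by rewrite -(perm_cons b) -(permPr (perm_to_rem bD)) -perm_rcons.
rewrite mem_permutations => -[bD h ->].
by rewrite perm_rcons (permPr (perm_to_rem bD)) perm_cons.
Qed.

Lemma num_standard_rec (D : seq (nat * nat)) : uniq D -> D != [::] ->
  num_standard D = \sum_(b <- [seq b <- D | maximal_in D b]) num_standard (rem b D).
Proof.
move=> uD nD; rewrite /num_standard (permP (permutations_rcons _ D uD nD)).
rewrite big_filter count_flatten -map_comp sumnE big_map [RHS]big_mkcond.
apply: eq_big_seq => b bD /=; rewrite count_map.
have main s : s \in permutations (rem b D) ->
    standard_order (rcons s b) = standard_order s && maximal_in D b.
  rewrite mem_permutations => ps; rewrite standard_order_rcons.
    congr (_ && _); rewrite /maximal_in (perm_all _ (perm_to_rem bD)) /=.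
    by rewrite /box_lt !ltnn !andbF /= (perm_all _ ps).
  by rewrite (perm_mem ps) mem_rem_uniqF.
rewrite (eq_in_count (a2 := fun s => standard_order s && maximal_in D b)) //.
case: ifP => _; first by apply: eq_count => s; rewrite andbT.
by rewrite (eq_count (a2 := pred0)) ?count_pred0 // => s; rewrite andbF.
Qed.

(* The last box of the row of the [i]-th part, with [i] counted from [0]. *)
Definition row_end (lam : seq nat) (i : nat) : nat * nat :=
  (i.+1, i.+1 + nth 0 lam i).

Lemma skew_uniq (lam mu : seq nat) : uniq (Defs.skew lam mu).
Proof. by rewrite filter_uniq ?diagram_uniq. Qed.

(** A maximal box ends its row, since every box to its right is outside [mu] too. If the row below
    reached the same column, its box there would be outside [mu] by strictness and contradict
    maximality. *)
Lemma maximal_skewP (lam mu : seq nat) (b : nat * nat) :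
  is_strict lam -> is_strict mu -> contains lam mu ->
  reflect (exists nu i, [/\ is_strict nu, i <= size nu, incr_nth nu i = lam,
             contains nu mu & b = row_end lam i])
          ((b \in Defs.skew lam mu) && maximal_in (Defs.skew lam mu) b).
Proof.
move=> sl sm /contains_nth cl0; apply: (iffP andP).
  case: b => r c [bs /allP mx].
  move: bs; rewrite mem_skew !mem_diagram /= => /andP[bm /and3P[r0 rc cl]].
  case: r => // i in bm r0 rc cl mx *; move: bm cl => /= bm cl.
  have notin k d : (k, d) \in Defs.skew lam mu -> ~~ box_lt (i.+1, c) (k, d).
    by move/mx.
  have ec : c = i.+1 + nth 0 lam i.
    have := notin i.+1 c.+1; rewrite mem_skew !mem_diagram /box_lt /= eqxx ltnSn.
    by lia.
  have hi : i < size lam by rewrite -strict_gt0 //; lia.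
  have rm : removable lam i.
    rewrite /removable hi /=; apply/negPn/negP => nr.
    have lt1 := strict_nth_lt lam i i.+1 sl (ltnSn _) hi.
    have lt2 : 0 < nth 0 mu i.+1 -> nth 0 mu i.+1 < nth 0 mu i.
      rewrite strict_gt0 // => h; apply: strict_nth_lt => //; lia.
    have := notin i.+2 c; rewrite mem_skew !mem_diagram /box_lt /= eqxx.
    by lia.
  case/removableP: rm => // nu [sn hn e]; exists nu, i; split=> //.
    apply/contains_nth => k; have := cl0 k.
    rewrite -{1}e nth_incr_nth; case: (i =P k) => [<-|//].
    by have := nth_incr_nth nu i i; rewrite e eqxx; lia.
  by rewrite ec.
move=> [nu [i [sn hi e /contains_nth cn eb]]].
have en k : nth 0 lam k = (i == k) + nth 0 nu k by rewrite -e nth_incr_nth.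
split.
  rewrite eb mem_skew !mem_diagram /= en eqxx; have := cn i; lia.
apply/allP => -[r c]; rewrite mem_skew !mem_diagram eb /box_lt /= => /andP[_ /and3P[r0 rc cl]].
apply/negP => /orP[/andP[/eqP er]|/andP[/eqP ec ir]].
  by move: cl; rewrite -er /=; lia.
have := strict_addn nu i r.-1 sn; rewrite -(strict_gt0 nu) //.
by move: cl rc ec ir r0; rewrite /= !en eqxx; case: (i =P r.-1); lia.
Qed.

(** The largest label sits at a corner whose removal leaves some [nu] containing [mu]. Summing over
    pairs [(nu, i)] prepares the exchange with a sum over [lam]. *)
Lemma nSYT_rec (lam mu : seq nat) (N : nat) :
  is_strict lam -> is_strict mu -> contains lam mu -> sumn lam = N.+1 ->
  sumn mu <= N ->
  nSYT lam mu = \sum_(nu <- strict_partitions N | contains nu mu)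
     \sum_(0 <= i < (size nu).+1 | incr_nth nu i == lam) nSYT nu mu.
Proof.
move=> sl sm clm sN smN.
(* The map [p |-> row_end lam p.2] matches these pairs with the maximal boxes of the skew shape. *)
pose L := [seq p <- [seq (nu, i) | nu <- strict_partitions N, i <- iota 0 (size nu).+1]
            | contains p.1 mu && (incr_nth p.1 p.2 == lam)].
have memL p : p \in L ->
    [/\ is_strict p.1, p.2 <= size p.1, incr_nth p.1 p.2 = lam & contains p.1 mu].
  rewrite mem_filter => /andP[/andP[h1 /eqP h2]] hp; case/allpairsPdep: hp => nu [i].
  rewrite mem_strict_partitions mem_iota => -[/andP[h3 _] h4 e].
  by move: h1 h2; rewrite e /=; split.
have uL : uniq L.
  apply/filter_uniq/allpairs_uniq_dep => [|nu _|[i j] [i' j'] _ _ /= [-> ->] //].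
    exact: undup_uniq.
  exact: iota_uniq.
have pL : perm_eq [seq row_end lam p.2 | p <- L]
    [seq b <- Defs.skew lam mu | maximal_in (Defs.skew lam mu) b].
  apply: uniq_perm.
  - rewrite map_inj_in_uniq // => -[nu i] [nu' i'] /memL[/= s1 _ e1 _] /memL[/= s2 _ e2 _].
    move=> [ei _]; rewrite ei; congr (_, _); rewrite ei in e1.
    by apply: (incr_nth_strict_inj _ _ i' s1 s2); rewrite e1 e2.
  - by rewrite filter_uniq ?skew_uniq.
  move=> b; rewrite mem_filter andbC; apply/mapP/maximal_skewP => //.
    by move=> [[nu i] /memL[/= h1 h2 h3 h4] ->]; exists nu, i.
  move=> [nu [i [h1 h2 h3 h4 ->]]]; exists (nu, i) => //.
  rewrite mem_filter; apply/andP; split; first by rewrite /= h4 h3 eqxx.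
  apply/allpairsPdep; exists nu, i.
  by rewrite mem_strict_partitions h1 mem_iota -eqSS -(sumn_incr_nth nu i) h3 sN eqxx; split.
rewrite [nSYT lam mu]num_standard_rec ?skew_uniq //; last first.
  (* An empty skew shape would force [lam = mu], against [sumn mu <= N]. *)
  apply/eqP => e0.
  have : sumn lam <= sumn mu; last by lia.
  have e : lam = mu.
    apply: strict_eq => // k; apply/eqP; rewrite eqn_leq andbC (contains_nth _ _ clm) /=.
    have : row_end lam k \notin Defs.skew lam mu by rewrite e0.
    rewrite mem_skew !mem_diagram /=; lia.
  by rewrite e.
rewrite -(perm_big _ pL) big_map.
rewrite (eq_big_seq (fun p => nSYT p.1 mu)) => [|[nu i] /memL[/= h1 h2 h3 h4]]; last first.
  apply: num_standard_perm.
  have d := diagram_incr_nth nu i; rewrite h3 in d.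
  have en : (i.+1, i.+1 + (nth 0 nu i).+1) = row_end lam i.
    by rewrite /row_end -h3 nth_incr_nth eqxx.
  rewrite en in d.
  rewrite -(perm_cons (row_end lam i)) -(permPl (perm_to_rem _)); last first.
    rewrite mem_skew (perm_mem d) mem_head andbT mem_diagram /= -h3 nth_incr_nth eqxx.
    by move/contains_nth: h4 => /(_ i); lia.
  rewrite (permPl (perm_filter _ d)) /= ifT //.
  rewrite mem_diagram /= -h3 nth_incr_nth eqxx.
  by move/contains_nth: h4 => /(_ i); lia.
rewrite big_filter big_mkcond big_allpairs_dep [RHS]big_mkcond.
apply: eq_bigr => nu _; rewrite /index_iota subn0 /=; case: ifP => h /=.
  by rewrite [RHS]big_mkcond.
by rewrite big1.
Qed.

(** * Hook lengths *)

Definition shift_box (b : nat * nat) : nat * nat := (b.1.+1, b.2.+1).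

Lemma diagram_cons (a : nat) (t : seq nat) :
  diagram (a :: t) = [seq (1, j) | j <- iota 2 a] ++ map shift_box (diagram t).
Proof.
rewrite /diagram /= (iotaDl 1 1 (size t)) map_flatten -!map_comp; congr (_ ++ flatten _).
apply/eq_in_map => i; rewrite mem_iota => /andP[i1 _] /=.
rewrite /part /= -[in RHS](prednK i1) /= (iotaDl 1) -!map_comp.
by case: i i1.
Qed.

(* The column of index [m + 1]: boxes of the first row of a diagram start at column [2]. *)
Definition column_length (t : seq nat) (m : nat) : nat :=
  count (fun b => b.2 == m.+1) (diagram t).

Lemma column_length_cons (b : nat) (t : seq nat) (m : nat) :
  column_length (b :: t) m.+1 = (m < b) + column_length t m.
Proof.
rewrite /column_length diagram_cons count_cat !count_map; congr (_ + _).
rewrite (eq_count (a2 := pred1 m.+2)) // count_uniq_mem ?iota_uniq // mem_iota.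
by rewrite add2n !ltnS.
Qed.

Lemma column_length0 (t : seq nat) : column_length t 0 = 0.
Proof.
apply/eqP; rewrite -leqn0 leqNgt -has_count; apply/hasPn => b.
by rewrite mem_diagram /=; lia.
Qed.

(** Row [i] starts in column [i + 1], so column [m + 1] can meet only the rows [1..m]; each reaches
    it because row ends weakly decrease and the last part is positive. *)
Lemma column_length_full (t : seq nat) (m : nat) :
  is_strict t -> m < size t -> column_length t m = m.
Proof.
elim: t m => [|b t IH] [|m] //= sbt mt; first by rewrite column_length0.
have h := strict_addn (b :: t) 0 (size t) sbt (leq0n _) (ltnSn _).
have := strict_gt0 (b :: t) (size t) sbt; rewrite ltnSn => h0.
rewrite column_length_cons IH //; last by move: sbt; rewrite is_strict_cons => /and3P[].
by rewrite /= in h h0; lia.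
Qed.

(** Here [b] serves as a strict bound on the parts of [t]: no row of [t] extends beyond column
    [b]. *)
Lemma column_length_out (t : seq nat) (b m : nat) :
  is_strict (b :: t) -> b <= m -> column_length t m = 0.
Proof.
elim: t b m => [|b' t IH] b [|m] //= sbt bm; first by rewrite column_length0.
move: sbt; rewrite is_strict_cons => /and3P[_ /= /andP[hb _] sbt].
by rewrite column_length_cons (IH b') //; lia.
Qed.

(** The summand [nth 0 t m] is the term [lam_j] of the hook length for [j = m + 2]; it is 0 from
    [m = size t] on. *)
Lemma hook_first_row (a : nat) (t : seq nat) (m : nat) : m < a ->
  hook (a :: t) (1, m.+2) = a - m + column_length t m + nth 0 t m.
Proof.
move=> ma; rewrite /hook diagram_cons !count_cat !count_map /part /=.
have -> : count (preim (pair 1) (fun c => (c.1 == 1) && (m.+2 < c.2))) (iota 2 a) = a - m.+1.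
  rewrite (eq_count (a2 := fun j => m.+2 < j)) //.
  rewrite -{1}(subnKC ma) iotaD count_cat.
  rewrite (eq_in_count (a2 := pred0)) ?count_pred0; last first.
    by move=> j; rewrite mem_iota /=; lia.
  rewrite (eq_in_count (a2 := predT)) ?count_predT ?size_iota // => j.
  by rewrite mem_iota /=; lia.
have -> : count (preim shift_box (fun c => (c.1 == 1) && (m.+2 < c.2))) (diagram t) = 0.
  by apply/eqP; rewrite -leqn0 leqNgt -has_count; apply/hasPn => b; rewrite mem_diagram /=; lia.
have -> : count (preim (pair 1) (fun c => (c.2 == m.+2) && (1 < c.1))) (iota 2 a) = 0.
  by apply/eqP; rewrite -leqn0 leqNgt -has_count; apply/hasPn => b _ /=; rewrite andbF.
have -> : count (preim shift_box (fun c => (c.2 == m.+2) && (1 < c.1))) (diagram t) =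
    column_length t m.
  by apply: eq_in_count => b; rewrite mem_diagram /=; lia.
lia.
Qed.

Lemma hook_shift (a : nat) (t : seq nat) (b : nat * nat) : b \in diagram t ->
  hook (a :: t) (shift_box b) = hook t b.
Proof.
case: b => i j; rewrite mem_diagram /= => hb.
rewrite /hook diagram_cons !count_cat !count_map /part /=.
rewrite !(eq_count (a2 := pred0) (a1 := preim (pair 1) _)) ?count_pred0 => [|k|k] /=; try lia.
have -> : nth 0 (a :: t) j = nth 0 t j.-1 by case: j hb => //; lia.
by [].
Qed.

(** Prepending [b] to [t] moves the factors with [m < b] one index up without changing them, as the
    columns grow by one. From [m = b] on the factors are [a - m], and only [a - b] is lost, which
    the new difference restores. *)
Lemma prod_first_row_tail (a : nat) (t : seq nat) : is_strict (a :: t) ->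
  (\prod_(size t <= m < a) (a - m + column_length t m)) * \prod_(b <- t) (a - b) = a`!.
Proof.
elim: t => [|b t IH] sat.
  rewrite big_nil muln1 fact_prod big_add1 /= big_nat_rev /=.
  by apply: eq_big_nat => m ma; rewrite /column_length /=; lia.
have [ba sa_t sbt lt_b] : [/\ b < a, is_strict (a :: t), is_strict (b :: t) & size t < b].
  have h := strict_addn (a :: b :: t) 1 (size t).+1 sat isT (ltnSn _).
  have := strict_gt0 (a :: b :: t) (size t).+1 sat; rewrite ltnSn => h0.
  move: sat; rewrite !is_strict_cons /= => /and3P[-> /andP[-> ->] /and3P[-> -> ->]].
  by split=> //; rewrite /= in h h0; lia.
rewrite -(IH sa_t) big_cons mulnA; congr (_ * _).
rewrite (big_cat_nat (n := b.+1)) //=; try lia.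
rewrite [RHS](big_cat_nat (n := b)) //=; try lia.
rewrite -mulnA; congr (_ * _).
  rewrite big_add1 /=; apply: eq_big_nat => m hm.
  rewrite column_length_cons; lia.
rewrite [RHS]big_ltn // (column_length_out _ b b) // addn0 mulnC; congr (_ * _).
apply: eq_big_nat => -[|m] hm; first by lia.
rewrite column_length_cons (column_length_out _ b m) // ?(column_length_out _ b m.+1) //; lia.
Qed.

(** For [m < size t] the column below is full and the hook length is [a - m + m + nth 0 t m], one of
    the sums [a + b]; the other columns together with the differences give [a!]. *)
Lemma Hprod_cons (a : nat) (t : seq nat) : is_strict (a :: t) ->
  Hprod (a :: t) * \prod_(b <- t) (a - b) = a`! * (\prod_(b <- t) (a + b)) * Hprod t.
Proof.
move=> sat; rewrite /Hprod [in LHS]diagram_cons big_cat !big_map /=.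
rewrite (eq_big_seq _ (hook_shift a t)) mulnAC; congr (_ * _).
rewrite -(prod_first_row_tail a t sat) mulnAC; congr (_ * _).
have st : is_strict t by move: sat; rewrite is_strict_cons => /and3P[].
have ha : size t <= a.
  have h := strict_addn (a :: t) 0 (size t) sat isT (ltnSn _).
  by rewrite /= in h; lia.
rewrite (iotaDl 2 0) big_map -[a in iota 0 a]subn0 -/(index_iota 0 a).
rewrite (eq_big_nat _ _ (F2 := fun m => a - m + column_length t m + nth 0 t m)); last first.
  by move=> m hm; exact: hook_first_row.
rewrite (big_cat_nat (n := size t)) //= mulnC; congr (_ * _).
  by apply: eq_big_nat => m hm; rewrite [nth _ _ _]nth_default ?addn0 //; lia.
rewrite [RHS](big_nth 0); apply: eq_big_nat => m hm.
rewrite column_length_full //; lia.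
Qed.

Local Open Scope ring_scope.

Fixpoint hook_prod (s : seq nat) : rat :=
  if s is a :: t
  then (a`!)%:R * \prod_(b <- t) ((a%:R + b%:R) / (a%:R - b%:R)) * hook_prod t
  else 1.

Lemma Hprod_hook_prod (lam : seq nat) : is_strict lam -> (Hprod lam)%:R = hook_prod lam.
Proof.
elim: lam => [|a t IH] st; first by rewrite /Hprod big_nil.
move: (st); rewrite is_strict_cons => /and3P[a0 /allP ha s_t] /=.
have h0 : \prod_(b <- t) (a%:R - b%:R) != 0 :> rat.
  rewrite prodf_seq_neq0; apply/allP => b bt /=.
  by rewrite subr_eq0 eqr_nat gtn_eqF // ha.
apply: (mulIf h0); rewrite -IH // prodf_div.
have -> : \prod_(b <- t) (a%:R - b%:R) = (\prod_(b <- t) (a - b))%N%:R :> rat.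
  by rewrite natr_prod; apply: eq_big_seq => b bt; rewrite natrB // ltnW // ha.
rewrite -natrM Hprod_cons // !natrM !natr_prod.
have -> : \prod_(i <- t) (a - i)%N%:R = \prod_(b <- t) (a%:R - b%:R) :> rat.
  by apply: eq_big_seq => b bt; rewrite natrB // ltnW // ha.
under eq_bigr do rewrite natrD.
by field.
Qed.

Lemma hook_prod_neq0 (lam : seq nat) : is_strict lam -> hook_prod lam != 0.
Proof.
elim: lam => [|a t IH] st //=.
move: (st); rewrite is_strict_cons => /and3P[a0 /allP ha s_t].
rewrite !mulf_neq0 ?IH ?pnatr_eq0 -?lt0n ?fact_gt0 //.
rewrite prodf_seq_neq0; apply/allP => b bt /=.
rewrite mulf_neq0 ?invr_eq0 ?subr_eq0 ?eqr_nat ?gtn_eqF ?ha //.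
by rewrite -natrD pnatr_eq0; lia.
Qed.

(* The factor gained by [(x + b) / (x - b)] when [x] becomes [x + 1]. *)
Definition growth (x b : nat) : rat :=
  (x%:R + 1 + b%:R) * (x%:R - b%:R) / ((x%:R + 1 - b%:R) * (x%:R + b%:R)).

(** Only [x!] and the factors pairing [x] with another part change. For a part before [x] both
    differences change sign, so the same [growth] appears; the hypothesis on [b] keeps the
    denominators nonzero. *)
Lemma hook_prod_incr (s t : seq nat) (x : nat) :
  (forall b, b \in s ++ t -> b != x /\ b != x.+1) ->
  hook_prod (s ++ x.+1 :: t) =
  hook_prod (s ++ x :: t) * (x%:R + 1) * \prod_(b <- s ++ t) growth x b.
Proof.
have nz b : b != x /\ b != x.+1 ->
    [/\ x%:R + b%:R != 0 :> rat, x%:R - b%:R != 0 :> rat & x%:R + 1 - b%:R != 0 :> rat].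
  move=> h; rewrite -natrD pnatr_eq0 subr_eq0 eqr_nat natr1 subr_eq0 eqr_nat.
  by split; lia.
elim: s => [|a s IH] /= h.
  have -> : \prod_(b <- t) ((x.+1%:R + b%:R) / (x.+1%:R - b%:R)) =
     \prod_(b <- t) ((x%:R + b%:R) / (x%:R - b%:R)) * \prod_(b <- t) growth x b :> rat.
    rewrite -big_split; apply: eq_big_seq => b /h/nz[h1 h2 h3] /=.
    by rewrite /growth -natr1; field; rewrite h1 h2 h3.
  by rewrite factS natrM -natr1; ring.
rewrite IH; last by move=> b bs; apply: h; rewrite inE bs orbT.
rewrite !(big_cat, big_cons) /=.
have /nz[h1 h2 h3] := h a (mem_head _ _).
have -> : (a%:R + x.+1%:R) / (a%:R - x.+1%:R) = (a%:R + x%:R) / (a%:R - x%:R) * growth x a :> rat.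
  rewrite /growth -natr1; field.
  by rewrite h1 h3 -(opprB x%:R) -(opprB (x%:R + 1)) !oppr_eq0 h2.
by ring.
Qed.

(* A fictitious part [0] lets the creation of a part [1] be treated as the growth of a part. *)
Lemma hook_prod_rcons0 (nu : seq nat) : all (leq 1) nu ->
  hook_prod (rcons nu 0%N) = hook_prod nu.
Proof.
elim: nu => [|a t IH] /=; first by rewrite big_nil !mulr1.
move=> /andP[a0 /IH ->]; rewrite -cats1 big_cat big_seq1 /=.
rewrite mulr0n !(addr0, subr0) divff ?mulr1 //.
by rewrite pnatr_eq0 -lt0n.
Qed.

(** * Divided differences *)

(** For distinct nodes this is the Newton divided difference of [f], in Lagrange form. *)
Definition divdiff {F : numFieldType} (us : seq F) (f : F -> F) : F :=
  \sum_(u <- us) f u / \prod_(w <- us | w != u) (u - w).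

(** The factor [z - u] kills the term of the node [u] and cancels one factor in every other
    denominator. *)
Lemma divdiff_cons {F : numFieldType} (u : F) (us : seq F) (f : F -> F) :
  u \notin us ->
  divdiff (u :: us) (fun z => (z - u) * f z) = divdiff us f.
Proof.
move=> uus; rewrite /divdiff big_cons subrr !mul0r add0r.
apply: eq_big_seq => x xus; rewrite big_cons.
have ux : u != x by apply: contraNneq uus => ->.
have h : x - u != 0 by rewrite subr_eq0 eq_sym.
by rewrite ux invfM mulrACA divff // mul1r.
Qed.

Lemma divdiffD {F : numFieldType} (us : seq F) (f g : F -> F) (a : F) :
  divdiff us (fun z => f z + a * g z) = divdiff us f + a * divdiff us g.
Proof.
rewrite /divdiff mulr_sumr -big_split; apply: eq_bigr => u _ /=.
by rewrite mulrDl mulrA.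
Qed.

Lemma eq_divdiff {F : numFieldType} (us : seq F) (f g : F -> F) :
  f =1 g -> divdiff us f = divdiff us g.
Proof. by move=> h; apply: eq_bigr => u _; rewrite h. Qed.

Lemma divdiff_perm {F : numFieldType} (us vs : seq F) (f : F -> F) :
  perm_eq us vs -> divdiff us f = divdiff vs f.
Proof.
move=> p; rewrite /divdiff (perm_big _ p); apply: eq_bigr => u _.
by rewrite (perm_big _ p).
Qed.

Lemma divdiff_1 {F : numFieldType} (us : seq F) : uniq us ->
  divdiff us (fun=> 1) = (size us == 1%N)%:R.
Proof.
case: us => [|u us]; first by rewrite /divdiff big_nil.
elim: us u => [|v us IH] u /=.
  by rewrite /divdiff big_seq1 big_cons eqxx big_nil divr1.
rewrite inE negb_or => /andP[/andP[uv uus] /andP[vus uni]].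
have vu : v - u != 0 by rewrite subr_eq0 eq_sym.
apply: (mulfI vu); rewrite mulr0.
(* Write [v - u] as [(z - u) - (z - v)]: each term drops one node, and the two remaining values
   agree by induction. *)
have -> : (v - u) * divdiff [:: u, v & us] (fun=> 1) =
    divdiff [:: u, v & us] (fun z => (z - u) * 1) -
    divdiff [:: u, v & us] (fun z => (z - v) * 1).
  by rewrite /divdiff mulr_sumr -sumrB; apply: eq_bigr => z _; ring.
have p : perm_eq [:: u, v & us] [:: v, u & us] by have /permPl := perm_catCA [:: u] [:: v] us.
rewrite (divdiff_cons u (v :: us) (fun=> 1)) ?inE ?negb_or ?uv //.
rewrite (divdiff_perm _ _ _ p) (divdiff_cons v (u :: us) (fun=> 1)).
  by rewrite !IH ?subrr //=; apply/andP.
by rewrite inE negb_or eq_sym uv.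
Qed.

Definition power_sum {F : numFieldType} (r : nat) (us : seq F) : F := \sum_(u <- us) u ^+ r.

(** The divided difference of [z ^ k] is the complete homogeneous symmetric polynomial of degree
    [k + 1 - size us] in the nodes, here in power sums. The recursion on the nodes comes from
    [z ^ k.+1 = (z - u) z ^ k + u z ^ k]. *)
Lemma divdiff_monomial {F : numFieldType} (us : seq F) : uniq us -> us != [::] ->
  [/\ forall k, (k.+1 < size us)%N -> divdiff us (fun z => z ^+ k) = 0,
      divdiff us (fun z => z ^+ (size us).-1) = 1,
      divdiff us (fun z => z ^+ size us) = power_sum 1 us
    & divdiff us (fun z => z ^+ (size us).+1) = (power_sum 1 us ^+ 2 + power_sum 2 us) / 2].
Proof.
case: us => // u us; elim: us u => [|v us IH] u uni _.
  have e k : divdiff [:: u] (fun z => z ^+ k) = u ^+ k.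
    by rewrite /divdiff big_seq1 big_cons eqxx big_nil divr1.
  by rewrite /power_sum !big_seq1 !e /=; split=> //; field.
have [uus uni'] := andP uni.
have [h0 h1 h2 h3] := IH v uni' isT.
have rec k : divdiff [:: u, v & us] (fun z => z ^+ k.+1) =
    divdiff (v :: us) (fun z => z ^+ k) + u * divdiff [:: u, v & us] (fun z => z ^+ k).
  by rewrite -(divdiff_cons u (v :: us)) // -divdiffD; apply: eq_divdiff => z; rewrite exprS; ring.
have z0 k : (k < (size us).+1)%N -> divdiff [:: u, v & us] (fun z => z ^+ k) = 0.
  elim: k => [|k IHk] hk; first exact: (divdiff_1 _ uni).
  by rewrite rec h0 // IHk ?mulr0 ?addr0 // ltnW.
have e1 : divdiff [:: u, v & us] (fun z => z ^+ (size us).+1) = 1.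
  by rewrite rec h1 z0 // mulr0 addr0.
have e2 : divdiff [:: u, v & us] (fun z => z ^+ (size us).+2) = power_sum 1 [:: u, v & us].
  by rewrite rec h2 e1 /power_sum !big_cons expr1; ring.
by split=> //; rewrite rec h3 e2 /power_sum !big_cons !expr1; field.
Qed.

(** These are the complete homogeneous polynomials of negative degree and of degrees 0, 1, 2 in the
    difference of alphabets [us - vs], obtained by expanding one factor [z - v] at a time. *)
Lemma divdiff_prod {F : numFieldType} (us vs : seq F) (k : nat) : uniq us -> us != [::] ->
  let D j := divdiff us (fun z => z ^+ j * \prod_(v <- vs) (z - v)) in
  let p r := power_sum r us - power_sum r vs in
  [/\ ((k + size vs).+1 < size us)%N -> D k = 0,
      (k + size vs).+1 = size us -> D k = 1,
      (k + size vs)%N = size us -> D k = p 1%N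
    & (k + size vs)%N = (size us).+1 -> D k = (p 1%N ^+ 2 + p 2%N) / 2].
Proof.
move=> uni nil /=; elim: vs k => [|v vs IH] k.
  have e j : divdiff us (fun z => z ^+ j * \prod_(v <- [::]) (z - v)) =
      divdiff us (fun z => z ^+ j).
    by apply: eq_divdiff => z; rewrite big_nil mulr1.
  have [h0 h1 h2 h3] := divdiff_monomial us uni nil.
  rewrite addn0 !e /power_sum !big_nil !subr0; split; first exact: h0.
  - by move=> ek; rewrite -h1 -ek.
  - by move=> ->.
  - by move=> ->.
have rec : divdiff us (fun z => z ^+ k * \prod_(w <- v :: vs) (z - w)) =
    divdiff us (fun z => z ^+ k.+1 * \prod_(w <- vs) (z - w)) -
    v * divdiff us (fun z => z ^+ k * \prod_(w <- vs) (z - w)).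
  rewrite -mulNr -divdiffD; apply: eq_divdiff => z.
  by rewrite big_cons exprS; ring.
have [a0 a1 a2 a3] := IH k.+1; have [b0 b1 b2 b3] := IH k.
rewrite rec /= /power_sum !big_cons !expr1 addnS; split=> h.
- by rewrite a0 // b0 ?mulr0 ?subrr // ltnW.
- by rewrite a1 // b0 ?mulr0 ?subr0 // -h.
- by rewrite a2 // b1 // /power_sum; under eq_bigr do rewrite expr1; ring.
- rewrite a3 // b2; last by case: h.
  by rewrite /power_sum; under eq_bigr do rewrite expr1; field.
Qed.

(** * Ratios of weights under the addition of a box *)

(** In the variable [node x] the four linear factors of [growth] pair up into two differences. Note
    that [pole x.+1] equals [node x]. *)
Definition node (x : nat) : rat := x%:R * (x%:R + 1).
Definition pole (x : nat) : rat := x%:R * (x%:R - 1).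

Lemma node_inj : injective node.
Proof.
have e x : node x = (x * x.+1)%:R by rewrite /node natrM -natr1.
move=> x y /eqP; rewrite !e eqr_nat => /eqP h.
by case: (ltngtP x y) => // xy; nia.
Qed.

Lemma growthE (x b : nat) : growth x b = (node x - node b) / (node x - pole b).
Proof. by rewrite /growth /node /pole; congr (_ / _); ring. Qed.

Lemma is_strict_incr (nu : seq nat) (i : nat) : is_strict nu -> (i <= size nu)%N ->
  is_strict (incr_nth nu i) = ((nth 0%N nu i).+1 \notin nu).
Proof.
move=> sn hi; set x := nth 0%N nu i.
have sz k : (k < size nu)%N -> (k < size (incr_nth nu i))%N.
  by rewrite size_incr_nth; case: ifP; lia.
apply/idP/idP => [sl|xn].
  apply/negP => /(nthP 0%N)[j hj ej].
  have : nth 0%N (incr_nth nu i) j == nth 0%N (incr_nth nu i) i.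
    by rewrite !nth_incr_nth eqxx ej -/x; case: (i =P j) ej => [<-|]; rewrite -/x; lia.
  have hi' : (i < size (incr_nth nu i))%N by rewrite size_incr_nth; case: ifP; lia.
  rewrite (nth_uniq _ (sz j hj) hi' (strict_uniq _ sl)).
  by move/eqP => e; move: ej; rewrite e -/x; lia.
have nx k : (k < size nu)%N -> nth 0%N nu k != x.+1.
  by move=> hk; apply: contraNneq xn => <-; rewrite mem_nth.
apply: nth_strictP => [|k hk].
  apply/(all_nthP 0%N) => k hk; rewrite nth_incr_nth.
  case: (i =P k) => // /eqP ik; rewrite strict_gt0 //.
  by move: hk; rewrite size_incr_nth; case: ifP; lia.
have hk' : (k < size nu)%N by move: hk; rewrite size_incr_nth; case: ifP; lia.
have := strict_nth_lt nu k k.+1 sn (ltnSn _) hk'; have := nx k hk'.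
rewrite !nth_incr_nth /x; case: (i =P k.+1) => [->|_]; last by lia.
by case: eqP; lia.
Qed.

Definition weight (lam : seq nat) : rat :=
  2 ^ ((sumn lam)%:Z - (size lam)%:Z) / (Hprod lam)%:R.

(** For [x] in [rcons nu 0], the residue at [z = node x] of the quotient of the [z - pole b] over
    [nu] by the [z - node b] over [rcons nu 0]; the node of 0 stands for the row that may be
    created. *)
Definition residue (nu : seq nat) (x : nat) : rat :=
  (\prod_(b <- nu) (node x - pole b)) / \prod_(b <- rcons nu 0%N | b != x) (node x - node b).

Lemma Hprod_neq0 (lam : seq nat) : is_strict lam -> (Hprod lam)%:R != 0 :> rat.
Proof. by move=> sl; rewrite Hprod_hook_prod // hook_prod_neq0. Qed.

Lemma weight_neq0 (lam : seq nat) : is_strict lam -> weight lam != 0.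
Proof. by move=> sl; rewrite mulf_neq0 ?invr_eq0 ?Hprod_neq0 // expfz_neq0. Qed.

Lemma rcons0_uniq (nu : seq nat) : is_strict nu -> uniq (rcons nu 0%N).
Proof.
move=> sn; rewrite rcons_uniq strict_uniq // andbT.
by apply/negP; case/andP: sn => _ /allP h /h.
Qed.

Lemma residue_split (nu s t : seq nat) (x : nat) : is_strict nu ->
  rcons nu 0%N = s ++ x :: t ->
  residue nu x = (\prod_(b <- nu) (node x - pole b)) / \prod_(b <- s ++ t) (node x - node b).
Proof.
move=> sn e; have := rcons0_uniq _ sn; rewrite e uniq_catC /= mem_cat => /andP[xst _].
rewrite /residue e; congr (_ / _).
rewrite !big_cat big_cons eqxx /=; congr (_ * _); rewrite big_mkcond;
  apply: eq_big_seq => b bs; rewrite ifT //; apply: contraNneq xst => <-; by rewrite bs ?orbT.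
Qed.

(** Applied with [p / h] the old weight, [c] the gain in the power of 2 and [y] the gain in the hook
    product; the case [y = 0] holds because the inverse of 0 is 0. *)
Lemma ratio_cancel (c p h y : rat) : p != 0 -> h != 0 ->
  c * p / (h * y) / (p / h) = c / y.
Proof.
move=> p0 h0; have [->|y0] := eqVneq y 0; first by rewrite mulr0 invr0 !(mulr0, mul0r).
by field; rewrite h0 y0.
Qed.

Lemma incr_nth_cat (s t : seq nat) (x : nat) :
  incr_nth (s ++ x :: t) (size s) = s ++ x.+1 :: t.
Proof. by elim: s => //= a s ->. Qed.

Lemma weight_ratio (nu : seq nat) (i : nat) : is_strict nu -> (i <= size nu)%N ->
  is_strict (incr_nth nu i) ->
  weight (incr_nth nu i) / weight nu = residue nu (nth 0%N nu i).
Proof.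
move=> sn hi sl; have un := strict_uniq _ sn.
have pn : all (leq 1) nu by case/andP: sn.
have n0 : 0%N \notin nu by apply/negP => /(allP pn).
have hn0 := hook_prod_neq0 _ sn.
move: (sl); rewrite is_strict_incr // => xn.
rewrite /weight !Hprod_hook_prod // sumn_incr_nth size_incr_nth.
move: hi xn; rewrite leq_eqVlt => /orP[/eqP ei|hi].
  rewrite ei ltnn nth_default // => xn.
  have -> : incr_nth nu (size nu) = nu ++ [:: 1%N].
    by elim: (nu) => //= a t ->.
  rewrite (hook_prod_incr nu [::] 0); last first.
    by move=> b; rewrite cats0 => bn; split; apply: contraTneq bn => ->.
  rewrite cats0 cats1 hook_prod_rcons0 // mulr0n add0r mulr1.
  (* A new part raises size and length together, so the power of 2 is unchanged. *)
  have -> : Posz (sumn nu).+1 - (size nu).+1%:Z = (sumn nu)%:Z - (size nu)%:Z by lia.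
  rewrite (residue_split nu nu [::] 0) ?cats0 -?cats1 //.
  rewrite (eq_bigr _ (fun b _ => growthE 0 b)) prodf_div.
  by rewrite -[X in X / _ / _]mul1r ratio_cancel ?expfz_neq0 // div1r invf_div.
rewrite hi; set x := nth 0%N nu i => xn.
have en : nu = take i nu ++ x :: drop i.+1 nu by rewrite -drop_nth // cat_take_drop.
have el : incr_nth nu i = take i nu ++ x.+1 :: drop i.+1 nu.
  by rewrite {1}en -[X in incr_nth _ X](size_takel (ltnW hi)) incr_nth_cat.
have x0 : x != 0%N by apply: contraNneq n0 => <-; rewrite mem_nth.
have perm : perm_eq nu (x :: take i nu ++ drop i.+1 nu).
  by rewrite {1}en perm_catC /= perm_cons perm_catC.
rewrite (residue_split nu (take i nu) (rcons (drop i.+1 nu) 0%N) x sn); last first.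
  by rewrite -rcons_cons -rcons_cat -en.
rewrite -rcons_cat big_rcons (perm_big _ perm) big_cons el hook_prod_incr -?en; last first.
  move=> b bs; have bn : b \in nu by rewrite (perm_mem perm) inE bs orbT.
  split; last by apply: contraNneq xn => <-.
  have := un; rewrite (perm_uniq perm) /= => /andP[+ _].
  by apply: contraNneq => <-.
rewrite (eq_bigr _ (fun b _ => growthE x b)) prodf_div.
have -> : Posz (sumn nu).+1 - (size nu)%:Z = 1 + ((sumn nu)%:Z - (size nu)%:Z) by lia.
rewrite expfzDr // expr1z -[_ * (x%:R + 1) * _]mulrA ratio_cancel ?expfz_neq0 //.
(* The factor [2 / (x + 1)] must match the two factors of the residue without counterpart in
   [growth]: [node x - pole x = 2 x] over [node x - node 0 = x (x + 1)]. *)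
rewrite !invfM invrK /= [node 0]mul0r subr0.
have xq : x%:R != 0 :> rat by rewrite pnatr_eq0.
have xq1 : x%:R + 1 != 0 :> rat by rewrite natr1 pnatr_eq0.
set d := \prod_(_ <- _) (_ - pole _); set n := (\prod_(_ <- _) _)^-1.
by rewrite /node /pole; field; rewrite xq xq1.
Qed.

Lemma divdiff_residue (nu : seq nat) (f : rat -> rat) : is_strict nu ->
  divdiff (map node (rcons nu 0%N)) (fun z => f z * \prod_(v <- map pole nu) (z - v)) =
  \sum_(x <- rcons nu 0%N) residue nu x * f (node x).
Proof.
move=> sn; rewrite /divdiff big_map; apply: eq_bigr => x _.
rewrite /residue !big_map [RHS]mulrAC; congr (_ / _); first exact: mulrC.
by apply: eq_bigl => b; rewrite (inj_eq node_inj).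
Qed.

(** The factor of [b = x + 1] vanishes, as [pole x.+1 = node x]; so the rows that cannot grow may be
    included in the sums. *)
Lemma residue_eq0 (nu : seq nat) (x : nat) : x.+1 \in nu -> residue nu x = 0.
Proof.
move=> xn; rewrite /residue (big_rem _ xn) /=.
have -> : node x - pole x.+1 = 0 by rewrite /node /pole -natr1; ring.
by rewrite !mul0r.
Qed.

Lemma sum_weight_ratio (nu : seq nat) (f : rat -> rat) : is_strict nu ->
  \sum_(0 <= i < (size nu).+1 | is_strict (incr_nth nu i))
      weight (incr_nth nu i) / weight nu * f (node (nth 0%N nu i)) =
  \sum_(x <- rcons nu 0%N) residue nu x * f (node x).
Proof.
move=> sn; rewrite [RHS](big_nth 0%N) size_rcons [LHS]big_mkcond.
apply: eq_big_nat => i /andP[_ hi].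
have -> : nth 0%N (rcons nu 0%N) i = nth 0%N nu i.
  rewrite nth_rcons; case: ltnP => // h; rewrite [RHS]nth_default //.
  by case: eqP.
case: ifP => [sl|]; first by rewrite weight_ratio.
by rewrite is_strict_incr // => /negbFE /residue_eq0 ->; rewrite mul0r.
Qed.

Definition cube_sum (nu : seq nat) : rat := \sum_(x <- nu) x%:R ^+ 3.

Lemma residue_moments (nu : seq nat) : is_strict nu ->
  [/\ \sum_(x <- rcons nu 0%N) residue nu x * 1 = 1,
      \sum_(x <- rcons nu 0%N) residue nu x * node x = 2 * (sumn nu)%:R
    & \sum_(x <- rcons nu 0%N) residue nu x * node x ^+ 2 =
      2 * (sumn nu)%:R ^+ 2 + 2 * cube_sum nu].
Proof.
move=> sn.
have un : uniq (map node (rcons nu 0%N)) by rewrite (map_inj_uniq node_inj) rcons0_uniq.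
have nn : map node (rcons nu 0%N) != [::] by case: (nu).
have D k := divdiff_prod _ (map pole nu) k un nn.
have p1 : power_sum 1 (map node (rcons nu 0%N)) - power_sum 1 (map pole nu) = 2 * (sumn nu)%:R.
  rewrite /power_sum !big_map -cats1 big_cat big_seq1 /= {2}/node mul0r expr0n addr0.
  rewrite -sumrB sumnE natr_sum mulr_sumr; apply: eq_bigr => x _.
  by rewrite /node /pole; ring.
have p2 : power_sum 2 (map node (rcons nu 0%N)) - power_sum 2 (map pole nu) = 4 * cube_sum nu.
  rewrite /power_sum !big_map -cats1 big_cat big_seq1 /= {2}/node mul0r expr0n addr0.
  rewrite -sumrB mulr_sumr; apply: eq_bigr => x _.
  by rewrite /node /pole; ring.
(* There is one more node than there are poles, so the exponents 0, 1, 2 give the homogeneous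
   polynomials of degrees 0, 1, 2. *)
have [_ d0 _ _] := D 0%N; have [_ _ d1 _] := D 1%N; have [_ _ _ d2] := D 2%N.
rewrite !size_map size_rcons in d0 d1 d2.
split.
- by rewrite -(divdiff_residue nu (fun=> 1)) // -[RHS]d0 //; apply: eq_divdiff => z; rewrite expr0.
- by rewrite -p1 -d1 // -(divdiff_residue nu id).
- by rewrite -(divdiff_residue nu (fun z => z ^+ 2)) // d2 // p1 p2; field.
Qed.

(** * Sums over chains of strict partitions *)

(** The new box has content [x + 1], and [(x + 2) (x + 1) x (x - 1)] is [node x (node x - 2)]. *)
Lemma content_term_incr (nu : seq nat) (i : nat) :
  (content_term (incr_nth nu i))%:R =
  (content_term nu)%:R + node (nth 0%N nu i) * (node (nth 0%N nu i) - 2) / 24 :> rat.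
Proof.
rewrite /content_term (perm_big _ (diagram_incr_nth nu i)) big_cons natrD addrC /=.
congr (_ + _); rewrite addKn; set x := nth 0%N nu i.
have e : ('C(x.+2, 4) * 24)%:R = node x * (node x - 2) :> rat.
  rewrite -[24%N]/(4`!) bin_ffact !ffactnS ffactn0 muln1 /node !natrM /=.
  (* Predecessors in [nat] stop at 0, so [x = 0] and [x = 1] are treated apart. *)
  case: x => [|[|x]] /=; rewrite -?natr1; ring.
by rewrite -e natrM mulfK.
Qed.

Lemma cube_sum_incr (nu : seq nat) (i : nat) : (i <= size nu)%N ->
  cube_sum (incr_nth nu i) = cube_sum nu + (3 * node (nth 0%N nu i) + 1).
Proof.
rewrite /cube_sum /node.
elim: nu i => [|a t IH] [|i] //= hi; first by rewrite big_seq1 big_nil; ring.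
  by rewrite !big_cons -natr1; ring.
by rewrite !big_cons IH //; ring.
Qed.

Lemma contains_incr (nu mu : seq nat) (i : nat) : contains nu mu -> contains (incr_nth nu i) mu.
Proof.
move=> /contains_nth h; apply/contains_nth => k; rewrite nth_incr_nth.
by apply: leq_trans (h k) _; apply: leq_addl.
Qed.

Definition path_sum (mu : seq nat) (n : nat) (g : seq nat -> rat) : rat :=
  \sum_(lam <- strict_partitions (sumn mu + n) | contains lam mu)
     weight lam * (nSYT lam mu)%:R * g lam.

(** A weighted average of [g] over the one-box enlargements of [nu]: for strict [nu] the
    coefficients add up to 1, by [up_cst]. *)
Definition up (g : seq nat -> rat) (nu : seq nat) : rat :=
  \sum_(0 <= i < (size nu).+1 | is_strict (incr_nth nu i))
     weight (incr_nth nu i) / weight nu * g (incr_nth nu i).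

(** Expand [nSYT] by its last box and exchange the sums over [lam] and [nu]; the quotient of weights
    in [up] then turns [weight nu] into [weight lam]. *)
Lemma path_sumS (mu : seq nat) (n : nat) (g : seq nat -> rat) : is_strict mu ->
  path_sum mu n.+1 g = path_sum mu n (up g).
Proof.
move=> sm; rewrite /path_sum.
pose S n := strict_partitions (sumn mu + n).
transitivity (\sum_(lam <- S n.+1 | contains lam mu) \sum_(nu <- S n | contains nu mu)
   \sum_(0 <= i < (size nu).+1 | incr_nth nu i == lam)
      weight (incr_nth nu i) * (nSYT nu mu)%:R * g (incr_nth nu i)).
  rewrite big_seq_cond [RHS]big_seq_cond; apply: eq_bigr => lam /andP[].
  rewrite mem_strict_partitions => /andP[sl /eqP lN] cl.
  rewrite (nSYT_rec lam mu (sumn mu + n)) //; [|by rewrite lN addnS|exact: leq_addr].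
  rewrite natr_sum mulr_sumr mulr_suml; apply: eq_bigr => nu _.
  rewrite natr_sum mulr_sumr mulr_suml; apply: eq_bigr => i /eqP ->.
  by [].
rewrite exchange_big /= big_seq_cond [RHS]big_seq_cond; apply: eq_bigr => nu /andP[].
rewrite mem_strict_partitions => /andP[sn /eqP nN] cn.
under eq_bigr => lam _ do rewrite big_mkcond.
rewrite exchange_big /= /up mulr_sumr [RHS]big_mkcond; apply: eq_bigr => i _.
rewrite -big_mkcondr; case: ifP => hs; last first.
  rewrite big_seq_cond big_pred0 // => lam; apply/negP => /and3P[].
  by rewrite mem_strict_partitions => /andP[sl _] _ /eqP e; rewrite e sl in hs.
rewrite big_mkcond (bigD1_seq (incr_nth nu i)) /=; last 2 first.
- by rewrite mem_strict_partitions hs sumn_incr_nth nN addnS eqxx.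
- exact: undup_uniq.
rewrite contains_incr // eqxx big1 ?addr0 => [|lam /negbTE ne]; last first.
  by rewrite eq_sym ne andbF.
by field; exact: weight_neq0.
Qed.

Lemma size_diagram (lam : seq nat) : size (diagram lam) = sumn lam.
Proof.
elim: lam => // a t IH.
by rewrite diagram_cons size_cat !size_map size_iota IH.
Qed.

Lemma contains_sumn_eq (lam mu : seq nat) : is_strict lam -> is_strict mu ->
  contains lam mu -> sumn lam = sumn mu -> lam = mu.
Proof.
move=> sl sm /contains_nth c e.
have sub : {subset diagram mu <= diagram lam}.
  move=> [r k]; rewrite !mem_diagram /= => /and3P[-> -> h] /=.
  by apply: leq_trans h _; rewrite leq_add2l.
have le : (size (diagram lam) <= size (diagram mu))%N by rewrite !size_diagram e.
have [_ eqm] := uniq_min_size (diagram_uniq mu) sub le.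
apply: strict_eq => // k; apply/eqP; rewrite eqn_leq c andbT.
have : (row_end lam k \in diagram mu) || (nth 0%N lam k == 0%N).
  by rewrite eqm mem_diagram /=; lia.
by rewrite mem_diagram /=; lia.
Qed.

Lemma path_sum0 (mu : seq nat) (g : seq nat -> rat) : is_strict mu ->
  path_sum mu 0 g = weight mu * g mu.
Proof.
move=> sm; rewrite /path_sum addn0.
have cm : contains mu mu by apply/contains_nth.
have mm : mu \in strict_partitions (sumn mu) by rewrite mem_strict_partitions sm eqxx.
rewrite big_mkcond (bigD1_seq mu) ?undup_uniq //= cm.
rewrite [X in _ + X]big1_seq ?addr0; last first.
  move=> lam /andP[/eqP ne]; rewrite mem_strict_partitions => /andP[sl /eqP e].
  by case: ifP => // c; case: ne; apply: contains_sumn_eq.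
have sk0 : Defs.skew mu mu = [::].
  apply/eqP; rewrite -size_eq0 size_filter -leqn0 leqNgt -has_count.
  by apply/hasPn => b ->.
by rewrite /nSYT sk0 /= mulr1.
Qed.

Lemma path_sum_ext (mu : seq nat) (n : nat) (g h : seq nat -> rat) :
  (forall nu, is_strict nu -> sumn nu = (sumn mu + n)%N -> g nu = h nu) ->
  path_sum mu n g = path_sum mu n h.
Proof.
move=> gh; rewrite /path_sum big_seq_cond [RHS]big_seq_cond; apply: eq_bigr => nu /andP[].
by rewrite mem_strict_partitions => /andP[sn /eqP nN] _; rewrite gh.
Qed.

Lemma up_local (g : seq nat -> rat) (f : rat -> rat) (nu : seq nat) : is_strict nu ->
  (forall i, (i <= size nu)%N -> g (incr_nth nu i) = f (node (nth 0%N nu i))) ->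
  up g nu = \sum_(x <- rcons nu 0%N) residue nu x * f (node x).
Proof.
move=> sn gf; rewrite -sum_weight_ratio // /up big_nat_cond [RHS]big_nat_cond.
by apply: eq_bigr => i /andP[/andP[_ hi] _]; rewrite gf.
Qed.

Lemma up_cst (c : rat) (nu : seq nat) : is_strict nu -> up (fun=> c) nu = c.
Proof.
move=> sn; rewrite (up_local _ (fun=> c)) //.
have [h _ _] := residue_moments nu sn.
transitivity (1 * c); last exact: mul1r.
by rewrite -h mulr_suml; apply: eq_bigr => x _; rewrite mulr1.
Qed.

Lemma up_cube_sum (nu : seq nat) : is_strict nu ->
  up cube_sum nu = cube_sum nu + (6 * (sumn nu)%:R + 1).
Proof.
move=> sn; rewrite (up_local _ (fun u => cube_sum nu + (3 * u + 1))) //; last first.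
  by move=> i hi; rewrite cube_sum_incr.
have [h0 h1 _] := residue_moments nu sn.
transitivity (\sum_(x <- rcons nu 0%N)
   ((cube_sum nu + 1) * (residue nu x * 1) + 3 * (residue nu x * node x))).
  by apply: eq_bigr => x _; ring.
by rewrite big_split -!mulr_sumr /= h0 h1; ring.
Qed.

Lemma up_content_term (nu : seq nat) : is_strict nu ->
  up (fun lam => (content_term lam)%:R) nu =
  (content_term nu)%:R + (cube_sum nu + (sumn nu)%:R ^+ 2 - 2 * (sumn nu)%:R) / 12.
Proof.
move=> sn; rewrite (up_local _ (fun u => (content_term nu)%:R + u * (u - 2) / 24)) //; last first.
  by move=> i hi; rewrite content_term_incr.
have [h0 h1 h2] := residue_moments nu sn.
transitivity (\sum_(x <- rcons nu 0%N) ((content_term nu)%:R * (residue nu x * 1) +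
   (1 / 24 * (residue nu x * node x ^+ 2) - 1 / 12 * (residue nu x * node x)))).
  by apply: eq_bigr => x _; field.
by rewrite big_split sumrB -!mulr_sumr /= h0 h1 h2; field.
Qed.

Lemma path_sumD (mu : seq nat) (n : nat) (g h : seq nat -> rat) :
  path_sum mu n (fun lam => g lam + h lam) = path_sum mu n g + path_sum mu n h.
Proof. by rewrite -big_split; apply: eq_bigr => lam _; rewrite mulrDr. Qed.

Lemma path_sumZ (mu : seq nat) (n : nat) (c : rat) (g : seq nat -> rat) :
  path_sum mu n (fun lam => g lam * c) = path_sum mu n g * c.
Proof. by rewrite [RHS]mulr_suml; apply: eq_bigr => lam _; rewrite mulrA. Qed.

Lemma path_sum_cst (mu : seq nat) (n : nat) (c : rat) : is_strict mu ->
  path_sum mu n (fun=> c) = weight mu * c.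
Proof.
move=> sm; elim: n => [|n IH]; first exact: path_sum0.
by rewrite path_sumS // -IH; apply: path_sum_ext => nu sn _; apply: up_cst.
Qed.

Lemma natr_bin2 (n : nat) : ('C(n, 2))%:R = n%:R * (n%:R - 1) / 2 :> rat.
Proof.
elim: n => [|n IH]; first by rewrite !mul0r.
by rewrite binS bin1 natrD IH -natr1; field.
Qed.

(** The step from level [k] adds [6 (|mu| + k) + 1] to the mean; summing over [k < n] gives the
    terms in [n]. *)
Lemma path_sum_cube (mu : seq nat) (n : nat) : is_strict mu ->
  path_sum mu n cube_sum =
  weight mu * (cube_sum mu + 6 * (sumn mu)%:R * n%:R + 6 * ('C(n, 2))%:R + n%:R).
Proof.
move=> sm; elim: n => [|n IH]; first by rewrite path_sum0 // bin0n !mulr0 !addr0.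
rewrite path_sumS // (path_sum_ext _ _ _ (fun nu => cube_sum nu + (6 * (sumn mu + n)%:R + 1))).
  by rewrite path_sumD path_sum_cst // IH !natr_bin2 natrD -(natr1 n); field.
by move=> nu sn <-; apply: up_cube_sum.
Qed.

Lemma path_sum_content (mu : seq nat) (n : nat) : is_strict mu ->
  path_sum mu n (fun lam => (content_term lam)%:R) =
  weight mu * ((content_term mu)%:R + 2 / 3 * ('C(n, 3))%:R + 2 / 3 * (sumn mu)%:R * ('C(n, 2))%:R
    + 1 / 12 * (cube_sum mu + (sumn mu)%:R ^+ 2 - 2 * (sumn mu)%:R) * n%:R).
Proof.
move=> sm; elim: n => [|n IH]; first by rewrite path_sum0 // !bin0n !mulr0 !addr0.
(* The size is constant on level [n], so the increment of the content sum involves only the mean of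
   [cube_sum], known from [path_sum_cube]. *)
pose k : rat := (sumn mu + n)%:R.
rewrite path_sumS // (path_sum_ext _ _ _ (fun nu => (content_term nu)%:R +
   (cube_sum nu * (1 / 12) + (k ^+ 2 - 2 * k) / 12))); last first.
  by move=> nu sn e; rewrite up_content_term // e -/k; field.
rewrite !path_sumD path_sum_cst // path_sumZ path_sum_cube // IH /k.
by rewrite !natr_bin2 binS !natrD natr_bin2 -(natr1 n); field.
Qed.

(** * Outer corners *)

(** The removed box ends its row, as the rows of [nu] are intervals. Were the row not removable, the
    next row would end in the same column and keep its last box in [nu], while the upper row became
    shorter, against strictness. *)
Lemma is_outer_cornerP (mu : seq nat) (b : nat * nat) : is_strict mu ->
  reflect (exists2 i, removable mu i & b = row_end mu i) (is_outer_corner mu b).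
Proof.
move=> sm; apply: (iffP andP) => [[bm /hasP[nu]]|[i rm ->]]; last first.
  have hi : (i < size mu)%N by case/andP: rm.
  have bm : row_end mu i \in diagram mu.
    by rewrite mem_diagram /=; move: hi; rewrite -strict_gt0 //; lia.
  split=> //; case/removableP: rm => // nu [sn _ e]; apply/hasP; exists nu.
    by rewrite mem_strict_partitions sn -e sumn_incr_nth eqxx.
  have p := diagram_incr_nth nu i; rewrite e in p.
  have eb : (i.+1, i.+1 + (nth 0 nu i).+1)%N = row_end mu i.
    by rewrite /row_end -e nth_incr_nth eqxx.
  rewrite eb (permPl (perm_to_rem bm)) perm_cons in p.
  by apply/andP; split; apply/allP => c; rewrite /= (perm_mem p).
rewrite mem_strict_partitions => /andP[sn _] /andP[/allP /= s1 /allP /= s2].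
have mem c : (c \in diagram nu) = (c != b) && (c \in diagram mu).
  by rewrite -[RHS](mem_rem_uniq b (diagram_uniq mu)); apply/idP/idP; [apply: s1|apply: s2].
case: b bm mem {s1 s2} => r c; rewrite mem_diagram /= => /and3P[r0 rc cl] mem.
case: r => // i in r0 rc cl mem *.
have hi : (i < size mu)%N by rewrite -strict_gt0 //; rewrite /= in cl; lia.
have nb : (i.+1 + nth 0 nu i < c)%N.
  by have := mem (i.+1, c); rewrite eqxx mem_diagram /=; lia.
have ec : c = (i.+1 + nth 0 mu i)%N.
  have := mem (i.+1, c.+1); rewrite !mem_diagram xpair_eqE /= in cl *; lia.
exists i; last by rewrite ec.
rewrite /removable hi /=; apply/negPn/negP => nr.
have lt1 := strict_nth_lt mu i i.+1 sm (ltnSn _) hi.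
have lt2 : (0 < nth 0 nu i.+1 -> nth 0 nu i.+1 < nth 0 nu i)%N.
  rewrite strict_gt0 // => h; apply: strict_nth_lt => //; lia.
have := mem (i.+2, c); rewrite !mem_diagram xpair_eqE /=; lia.
Qed.

(** A row has at most one corner, so the order by rows is antisymmetric on corners and the sorted
    list is unique; decreasing [alpha] means listing rows from the bottom up. *)
Lemma cornersE (mu : seq nat) : is_strict mu ->
  corners mu = [seq row_end mu i | i <- rev (iota 0 (size mu)) & removable mu i].
Proof.
move=> sm.
have pm : perm_eq (corners mu) [seq row_end mu i | i <- rev (iota 0 (size mu)) & removable mu i].
  rewrite perm_sort; apply: uniq_perm.
  - by rewrite filter_uniq // diagram_uniq.
  - rewrite map_inj_uniq; first by rewrite filter_uniq // rev_uniq iota_uniq.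
    by move=> i j [].
  move=> b; rewrite mem_filter; apply/andP/mapP => [[/is_outer_cornerP[] // i rm -> _]|[i]].
    by exists i => //; rewrite mem_filter rm mem_rev mem_iota; case/andP: rm.
  rewrite mem_filter => /andP[rm _] ->.
  have oc : is_outer_corner mu (row_end mu i) by apply/is_outer_cornerP => //; exists i.
  by split=> //; case/andP: oc.
apply: (sorted_eq_in (leT := fun a b => (b.1 <= a.1)%N) _ _ _ _ pm).
- by move=> x y z _ _ _ /=; lia.
- move=> x y; rewrite !(perm_mem pm) => /mapP[i _ ->] /mapP[j _ ->] /= h.
  by have -> : i = j by lia.
- by apply: sort_sorted => x y /=; lia.
rewrite sorted_map; apply: sorted_filter; first by move=> x y z /=; lia.
rewrite rev_sorted; apply: sub_sorted (iota_sorted 0 (size mu)) => x y /=; lia.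
Qed.

(** Whether a lower row is removable does not depend on [a], and the corner of the first row, if
    any, comes last. *)
Lemma corners_cons (a : nat) (t : seq nat) : is_strict (a :: t) ->
  corners (a :: t) = map shift_box (corners t) ++
    (if removable (a :: t) 0 then [:: (1, a.+1)%N] else [::]).
Proof.
move=> sat; have st : is_strict t by move: sat; rewrite is_strict_cons => /and3P[].
rewrite !cornersE // /= rev_cons (iotaDl 1 0) -map_rev -cats1 filter_cat map_cat.
congr (_ ++ _); last by rewrite /=; case: ifP.
by rewrite filter_map -!map_comp.
Qed.

(* By induction on the largest part [a].  Either [a] starts a new run of consecutive
   parts, which adds [(x, y) = (a + 1, a)] to [q2], or it extends the run of [a - 1],
   which increases the last [x] from [a] to [a + 1]; both change [q2] by
   ['C(a + 1, 2)^2 - 'C(a, 2)^2 = a^3].  The second conjunct gives the last [x]. *)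
Lemma q2_cube_sum_head (mu : seq nat) : is_strict mu ->
  q2 mu = cube_sum mu /\ beta mu (size (corners mu)) = (nth 0%N mu 0).+1%:Z.
Proof.
elim: mu => [|a t IH] sat.
  by rewrite /q2 /beta !cornersE // /= big_nat1 big_geq // /cube_sum big_nil /beta /alpha !cornersE.
have st : is_strict t by move: sat; rewrite is_strict_cons => /and3P[].
have [IHq IHb] := IH st.
have lta : (nth 0 t 0 < a)%N.
  by apply: (strict_nth_lt (a :: t) 0 1).
have := corners_cons a t sat; set m := size (corners t) => ec.
have eal i : (0 < i <= m)%N -> alpha (a :: t) i = alpha t i + 1.
  case: i => // i /andP[_ im]; rewrite /alpha ec /= nth_cat size_map -/m im.
  by rewrite (nth_map (0%N, 0%N)) //= intS addrC.
have ebe i : (i <= m)%N -> beta (a :: t) i = beta t i + 1.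
  case: i => [|i] im; first by rewrite /beta /= [LHS]intS addrC.
  rewrite /beta ec /= nth_cat size_map -/m im.
  by rewrite (nth_map (0%N, 0%N)) //= intS addrC.
(* The convention [alpha_{m+1} = 0] is the default [(0, 0)] of [nth]. *)
have am : alpha t m.+1 = 0 by rewrite /alpha nth_default.
have cu : cube_sum (a :: t) = a%:R ^+ 3 + cube_sum t by rewrite /cube_sum big_cons.
(* The shift by [(1, 1)] preserves every difference of a [beta] and an [alpha] except the last [x]
   of [t], whose [alpha] is the unshifted 0; that term is set aside. *)
have sums : \sum_(0 <= i < m) binom2 (beta (a :: t) i - alpha (a :: t) i.+1) ^+ 2
    - \sum_(1 <= j < m.+1) binom2 (beta (a :: t) j - alpha (a :: t) j) ^+ 2
    = cube_sum t - binom2 (beta t m) ^+ 2.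
  rewrite -IHq /q2 -/m [in RHS]big_nat_recr //= am subr0.
  rewrite [RHS]addrAC addrK; congr (_ - _).
    apply: eq_big_nat => i /andP[_ im]; rewrite (ebe i (ltnW im)) (eal i.+1 im).
    by congr (binom2 _ ^+ _); ring.
  apply: eq_big_nat => i im; rewrite (eal i im) ebe; last by case/andP: im.
  by congr (binom2 _ ^+ _); ring.
have := ec; case: ifP => [rm|nrm] {}ec.
  have sz : size (corners (a :: t)) = m.+1 by rewrite ec size_cat size_map /= addn1.
  have a1 : alpha (a :: t) m.+1 = 1.
    by rewrite /alpha ec nth_cat size_map -/m ltnn subnn.
  have a2 : alpha (a :: t) m.+2 = 0 by rewrite /alpha nth_default // sz.
  have b1 : beta (a :: t) m.+1 = a.+1%:Z.
    by rewrite /beta ec nth_cat size_map -/m ltnn subnn.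
  split; last by rewrite sz b1.
  rewrite /q2 sz big_nat_recr //= big_nat_recr //= [X in _ - X]big_nat_recr //=.
  rewrite a1 a2 b1 ebe // addrK subr0 cu.
  rewrite -[cube_sum t](subrK (binom2 (beta t m) ^+ 2)) -sums.
  have -> : a.+1%:Z - 1 = a by lia.
  by rewrite /binom2 -!pmulrn -natr1; field.
have sz : size (corners (a :: t)) = m by rewrite ec cats0 size_map.
have a1 : alpha (a :: t) m.+1 = 0 by rewrite /alpha nth_default // sz.
have ea : a = (nth 0%N t 0).+1.
  by move: nrm; rewrite /removable /=; lia.
have bm : beta (a :: t) m = a.+1%:Z by rewrite ebe // IHb -ea; lia.
split; last by rewrite sz bm.
rewrite /q2 sz big_nat_recr //= a1 bm subr0 cu.
rewrite -[cube_sum t](subrK (binom2 (beta t m) ^+ 2)) -sums IHb -ea.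
by rewrite /binom2 -!pmulrn -natr1; field.
Qed.

Theorem theorem4p3 (mu : seq nat) (Hmu : is_strict mu) (n : nat) :
  \sum_(lam <- strict_partitions (sumn mu + n) | contains lam mu)
     ((2%:Q) ^ ((sumn lam)%:Z - (size lam)%:Z - (sumn mu)%:Z + (size mu)%:Z)
      * (nSYT lam mu)%:R * (Hprod mu)%:R / (Hprod lam)%:R
      * ((content_term lam)%:R - (content_term mu)%:R))
  = 2 / 3 * ('C(n, 3))%:R + 2 / 3 * (sumn mu)%:R * ('C(n, 2))%:R
    + 1 / 12 * (q2 mu + (sumn mu)%:R ^+ 2 - 2 * (sumn mu)%:R) * n%:R.
Proof.
have w0 := weight_neq0 mu Hmu.
(* Dividing by [weight mu] accounts for [H_mu] and the power of 2 attached to [mu]; the constant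
   [content_term mu] is then handled by [path_sum_cst]. *)
transitivity
  (path_sum mu n (fun lam => (content_term lam)%:R + - (content_term mu)%:R) / weight mu).
  rewrite mulr_suml; apply: eq_bigr => lam _.
  have -> : (sumn lam)%:Z - (size lam)%:Z - (sumn mu)%:Z + (size mu)%:Z =
    ((sumn lam)%:Z - (size lam)%:Z) - ((sumn mu)%:Z - (size mu)%:Z) by ring.
  rewrite expfzDr // -invr_expz /weight invf_div; ring.
rewrite path_sumD path_sum_cst // path_sum_content //.
have [-> _] := q2_cube_sum_head mu Hmu.
by field.
Qed.
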